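(* If $M$ is a $\lambda\mu I$-term, then a standard reduction sequence starting from $M$ and leading to the normal form of $M$ is the leftmost reduction sequence, and it is a reduction sequence of maximal length (among the reduction sequences starting from $M$).
   Context: Terms are generated from $\lambda$-variables $x,y,\dots$ and $\mu$-variables $\alpha,\beta,\dots$ by $\mathcal T::=x\mid \lambda x.\mathcal T\mid\mu\alpha.\mathcal T\mid[\alpha]\mathcal T\mid(\mathcal T\,\mathcal T)$, modulo renaming of bound variables; application associates to the left. $comp(x)=1$, $comp([\alpha]M)=comp(\lambda x.M)=comp(\mu\alpha.M)=comp(M)+1$, $comp(M\,N)=comp(M)+comp(N)$. Types: built from atomic types and $\bot$ with $\to$; $\neg A$ is $A\to\bot$. Typing: $\Gamma,x:A\vdash x:A$; $\Gamma,x:A\vdash M:B$ gives $\Gamma\vdash\lambda x.M:A\to B$; $\Gamma\vdash M:A\to B$, $\Gamma\vdash N:A$ give $\Gamma\vdash M\,N:B$; $\Gamma,\alpha:\neg A\vdash M:A$ gives $\Gamma,\alpha:\neg A\vdash[\alpha]M:\bot$; $\Gamma,\alpha:\neg A\vdash M:\bot$ gives $\Gamma\vdash\mu\alpha.M:A$. All terms considered are typable (hence strongly normalizing, with a unique normal form). Reduction rules: $(\lambda x.M)N\to_\beta M[x:=N]$; $(\mu\alpha.M)N\to_\mu\mu\alpha.M[\alpha:=_rN]$, where $[\alpha:=_rN]$ (recursively) replaces each subterm $[\alpha]U$ ($\alpha$ free) by $[\alpha](U\,N)$; $[\alpha]\mu\beta.M\to_\rho M[\beta:=\alpha]$; $\mu\alpha.[\alpha]M\to_\theta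 M$ if $\alpha\notin Fv(M)$. $M\mapsto^\sigma N$: $\sigma=[R_1,\dots,R_n]$ is a sequence of contracted redex occurrences leading from $M$ to $N$, $|\sigma|=n$; $\#$ is concatenation. $NF$ is the set of terms without redexes. $\lambda\mu I$-terms: variables; $(M\,N)$ and $[\alpha]M$ for $\lambda\mu I$-terms $M,N$; $\lambda x.M$ for a $\lambda\mu I$-term $M$ with $x\in Fv(M)$; $\mu\alpha.M$ for a $\lambda\mu I$-term $M$ with $\alpha\in Fv(M)$. Leftmost redex $lr(M)$ (undefined in cases not listed): $lr(\lambda x.M)=lr(M)$; $lr(\mu\alpha.M)=\mu\alpha.M$ if this is a $\theta$-redex, else $lr(M)$; $lr([\alpha]M)=[\alpha]M$ if this is a $\rho$-redex, else $lr(M)$; $lr((\mu\alpha.M_1)M_2\vec P)=(\mu\alpha.M_1)M_2$; $lr((\lambda x.M_1)M_2\vec P)=(\lambda x.M_1)M_2$; $lr(x\,M_1\dots M_n)=lr(M_i)$ if $M_i\notin NF$ and $M_j\in NF$ for $j<i$. A reduction sequence is leftmost if each step contracts the leftmost redex. Standard sequences (recursion on $(|\sigma|,comp(M))$, lexicographically). $M\mapsto^\sigma N$ is standard if it is empty or one of the following holds. (1) $M=\lambda x.M_1$, $N=\lambda x.N_1$, $M_1\mapsto^\sigma N_1$ is standard. (2) $M=\mu\alpha.M_1$, with $\sigma$ being $M=P_1\to\cdots\to P_{k+1}=N$, and either (a) $N=\mu\alpha.N_1$, $M_1\mapsto^\sigma N_1$ is standard and no $P_j$ is a $\theta$-redex;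 or (b) $P_j=\mu\alpha.[\alpha]M'$ is the first $P_j$ that is a $\theta$-redex, the initial part $\sigma'$ of $\sigma$ up to $P_j$ is standard (as a sequence $M_1\mapsto^{\sigma'}[\alpha]M'$), and the rest is either (i) $P_j\to_\theta M'\mapsto^{\sigma''}N$ with $\sigma''$ standard, or (ii) $P_j\mapsto^{\sigma'''}\mu\alpha.[\alpha]N'=N$ with $M'\mapsto^{\sigma'''}N'$ standard. (3) $M=[\alpha]M_1$, with $\sigma$ being $M=P_1\to\cdots\to P_{k+1}=N$, and either (a) $N=[\alpha]N_1$, $M_1\mapsto^\sigma N_1$ is standard and no $P_j$ is a $\rho$-redex; or (b) $P_j=[\alpha]\mu\beta.M'$ is the first $P_j$ that is a $\rho$-redex, the initial part $\sigma'$ of $\sigma$ up to $P_j$ is standard (as a sequence $M_1\mapsto^{\sigma'}\mu\beta.M'$), and the rest is either (i) $P_j\to_\rho M'[\beta:=\alpha]\mapsto^{\sigma''}N$ with $\sigma''$ standard, or (ii) $P_j\mapsto^{\sigma'''}[\alpha]\mu\beta.N'=N$ with $M'\mapsto^{\sigma'''}N'$ standard. (4) $M=(\lambda x.M_1)M_2\dots M_n$ ($n\ge2$) and either (a) $M\to_\beta(M_1[x:=M_2]\,M_3\dots M_n)\mapsto^{\sigma_1}N$ with $\sigma_1$ standard, or (b) $N=(\lambda x.N_1)N_2\dots N_n$ and $\sigma=\sigma_1\#\cdots\#\sigma_n$ with $\lambda x.M_1\mapsto^{\sigma_1}\lambda x.N_1$ and $M_i\mapsto^{\sigma_i}N_i$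 ($i\ge2$) standard. (5) $M=(\mu\alpha.M_1)M_2\dots M_n$ ($n\ge2$) and either (a) $M\to_\mu(\mu\alpha.M_1[\alpha:=_rM_2])M_3\dots M_n\mapsto^{\sigma_1}N$ with $\sigma_1$ standard, or (b) $N=(\mu\alpha.N_1)N_2\dots N_n$ and $\sigma=\sigma_1\#\cdots\#\sigma_n$ with $\mu\alpha.M_1\mapsto^{\sigma_1}\mu\alpha.N_1$ (the prefix $\mu\alpha$ being kept, i.e. never contracted as a $\theta$-redex) and $M_i\mapsto^{\sigma_i}N_i$ ($i\ge2$) standard. (6) $M=(x\,M_1\dots M_n)$, $N=(x\,N_1\dots N_n)$, $\sigma=\sigma_1\#\cdots\#\sigma_n$ with $M_i\mapsto^{\sigma_i}N_i$ standard. *)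

(* Defs.v *)
From Stdlib Require Import List Arith.
Import ListNotations.

(* Terms modulo renaming of bound variables: de Bruijn indices, with two
   independent index spaces. [Lam] binds index 0 of the lambda-variables, [Mu]
   binds index 0 of the mu-variables; [Named a M] is [alpha]M. *)
Inductive term : Type :=
| Var : nat -> term
| Lam : term -> term
| Mu : term -> term
| Named : nat -> term -> term
| App : term -> term -> term.

Definition apps (M : term) (Ms : list term) : term := fold_left App Ms M.

Fixpoint lam_free (x : nat) (M : term) : Prop :=
  match M with
  | Var y => x = y
  | Lam M => lam_free (S x) M
  | Mu M => lam_free x M
  | Named _ M => lam_free x M
  | App M N => lam_free x M \/ lam_free x N
  end.

Fixpoint mu_free (a : nat) (M : term) : Prop :=
  match M with
  | Var _ => False
  | Lam M => mu_free a M
  | Mu M => mu_free (S a) M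
  | Named b M => a = b \/ mu_free a M
  | App M N => mu_free a M \/ mu_free a N
  end.

Definition up (f : nat -> nat) (n : nat) : nat :=
  match n with 0 => 0 | S n => S (f n) end.

(* [f] renames the lambda-variables, [g] the mu-variables. *)
Fixpoint ren (f g : nat -> nat) (M : term) : term :=
  match M with
  | Var x => Var (f x)
  | Lam M => Lam (ren (up f) g M)
  | Mu M => Mu (ren f (up g) M)
  | Named a M => Named (g a) (ren f g M)
  | App M N => App (ren f g M) (ren f g N)
  end.

Definition id_ren (n : nat) : nat := n.
Definition lift_lam : term -> term := ren S id_ren.
Definition lift_mu : term -> term := ren id_ren S.

Definition up_subst (s : nat -> term) (n : nat) : term :=
  match n with 0 => Var 0 | S n => lift_lam (s n) end.

Fixpoint subst (s : nat -> term) (M : term) : term :=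
  match M with
  | Var x => s x
  | Lam M => Lam (subst (up_subst s) M)
  | Mu M => Mu (subst (fun n => lift_mu (s n)) M)
  | Named a M => Named a (subst s M)
  | App M N => App (subst s M) (subst s N)
  end.

(* M[x:=N], where x is index 0, which disappears. *)
Definition subst0 (N M : term) : term :=
  subst (fun n => match n with 0 => N | S n => Var n end) M.

(* M[beta:=alpha], where beta is index 0, which disappears. *)
Definition mu_rename0 (a : nat) (M : term) : term :=
  ren id_ren (fun n => match n with 0 => a | S n => n end) M.

(* Moves M out of the scope of index 0, when that index is not free in M. *)
Definition mu_lower (M : term) : term := ren id_ren Nat.pred M.

(* M[alpha:=_r N], where alpha is index [a], which remains. *)
Fixpoint mu_subst (a : nat) (N M : term) : term :=
  match M with
  | Var x => Var x
  | Lam M => Lam (mu_subst a (lift_lam N) M)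
  | Mu M => Mu (mu_subst (S a) (lift_mu N) M)
  | Named b M =>
      if b =? a then Named b (App (mu_subst a N M) N)
      else Named b (mu_subst a N M)
  | App M1 M2 => App (mu_subst a N M1) (mu_subst a N M2)
  end.

(* The contractum of (mu alpha. M) N. *)
Definition mu_contractum (M N : term) : term := Mu (mu_subst 0 (lift_mu N) M).

Inductive type : Type :=
| Atom : nat -> type
| Bot : type
| Arr : type -> type -> type.

Definition Neg (A : type) : type := Arr A Bot.

(* [G] declares the lambda-variables, [D] the mu-variables. *)
Inductive has_type : list type -> list type -> term -> type -> Prop :=
| T_var G D x A :
    nth_error G x = Some A -> has_type G D (Var x) A
| T_lam G D M A B :
    has_type (A :: G) D M B -> has_type G D (Lam M) (Arr A B)
| T_app G D M N A B :
    has_type G D M (Arr A B) -> has_type G D N A -> has_type G D (App M N) B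
| T_named G D a M A :
    nth_error D a = Some (Neg A) -> has_type G D M A ->
    has_type G D (Named a M) Bot
| T_mu G D M A :
    has_type G (Neg A :: D) M Bot -> has_type G D (Mu M) A.

Definition typable (M : term) : Prop := exists G D A, has_type G D M A.

Inductive lambda_mu_I : term -> Prop :=
| I_var x : lambda_mu_I (Var x)
| I_app M N : lambda_mu_I M -> lambda_mu_I N -> lambda_mu_I (App M N)
| I_named a M : lambda_mu_I M -> lambda_mu_I (Named a M)
| I_lam M : lambda_mu_I M -> lam_free 0 M -> lambda_mu_I (Lam M)
| I_mu M : lambda_mu_I M -> mu_free 0 M -> lambda_mu_I (Mu M).

Definition rho_redex (M : term) : Prop := exists a U, M = Named a (Mu U).

Definition theta_redex (M : term) : Prop :=
  exists U, M = Mu (Named 0 U) /\ ~ mu_free 0 U.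

Inductive contract : term -> term -> Prop :=
| C_beta M N : contract (App (Lam M) N) (subst0 N M)
| C_mu M N : contract (App (Mu M) N) (mu_contractum M N)
| C_rho a M : contract (Named a (Mu M)) (mu_rename0 a M)
| C_theta M : ~ mu_free 0 M -> contract (Mu (Named 0 M)) (mu_lower M).

(* Redex occurrences are given by their position, the path from the root of the
   term: [Body] enters [Lam], [Mu] or [Named]; [Fun] and [Arg] enter [App]. A
   contractum alone would not determine the redex: mu a.[a]mu b.M may have the
   same theta- and rho-contractum. *)
Inductive dir : Type := Body | Fun | Arg.
Definition pos : Type := list dir.
Definition redseq : Type := list pos.

Inductive step : pos -> term -> term -> Prop :=
| S_root M N : contract M N -> step [] M N
| S_lam p M N : step p M N -> step (Body :: p) (Lam M) (Lam N)
| S_mu p M N : step p M N -> step (Body :: p) (Mu M) (Mu N)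
| S_named p a M N : step p M N -> step (Body :: p) (Named a M) (Named a N)
| S_fun p M N P : step p M N -> step (Fun :: p) (App M P) (App N P)
| S_arg p M N P : step p M N -> step (Arg :: p) (App P M) (App P N).

Inductive reduces : term -> redseq -> term -> Prop :=
| R_nil M : reduces M [] M
| R_cons M p P s N : step p M P -> reduces P s N -> reduces M (p :: s) N.

Definition NF (M : term) : Prop := forall p N, ~ step p M N.

(* [lr M p]: the leftmost redex of M is defined and occurs at position p. *)
Inductive lr : term -> pos -> Prop :=
| lr_lam M p : lr M p -> lr (Lam M) (Body :: p)
| lr_theta M : theta_redex (Mu M) -> lr (Mu M) []
| lr_mu M p : ~ theta_redex (Mu M) -> lr M p -> lr (Mu M) (Body :: p)
| lr_rho a M : rho_redex (Named a M) -> lr (Named a M) []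
| lr_named a M p :
    ~ rho_redex (Named a M) -> lr M p -> lr (Named a M) (Body :: p)
| lr_head_mu M1 M2 Ps :
    lr (apps (App (Mu M1) M2) Ps) (repeat Fun (length Ps))
| lr_head_beta M1 M2 Ps :
    lr (apps (App (Lam M1) M2) Ps) (repeat Fun (length Ps))
| lr_head_var x Ms M Ms' p :
    Forall NF Ms -> ~ NF M -> lr M p ->
    lr (apps (Var x) (Ms ++ M :: Ms')) (repeat Fun (length Ms') ++ Arg :: p).

Inductive leftmost_reduction : term -> redseq -> term -> Prop :=
| L_nil M : leftmost_reduction M [] M
| L_cons M p P s N :
    lr M p -> step p M P -> leftmost_reduction P s N ->
    leftmost_reduction M (p :: s) N.

(* The sequence [s], performed in an immediate subterm. *)
Definition under (d : dir) (s : redseq) : redseq := map (cons d) s.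

(* [s0] performed in M, then [ss] in the successive elements of Ms, all seen as
   steps of [apps M Ms]. *)
Definition spine_seq (s0 : redseq) (ss : list redseq) : redseq :=
  fold_left (fun s si => under Fun s ++ under Arg si) ss s0.

(* No term of the sequence [s] starting from M, including the last one,
   satisfies X. *)
Definition never (X : term -> Prop) (M : term) (s : redseq) : Prop :=
  forall s1 s2 P, s = s1 ++ s2 -> reduces M s1 P -> ~ X P.

(* The same, excluding the last term. *)
Definition not_before_end (X : term -> Prop) (M : term) (s : redseq) : Prop :=
  forall s1 p s2 P, s = s1 ++ p :: s2 -> reduces M s1 P -> ~ X P.

(* The defining recursion on the length of s and then the size of M is
   well-founded, so that its unique solution is the least predicate closed under
   the clauses. *)
Inductive standard : term -> redseq -> term -> Prop :=
| std_empty M : standard M [] M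
| std_lam M s N :
    standard M s N -> standard (Lam M) (under Body s) (Lam N)
| std_mu M s N :
    standard M s N -> never theta_redex (Mu M) (under Body s) ->
    standard (Mu M) (under Body s) (Mu N)
| std_mu_theta M s1 U s2 N :
    standard M s1 (Named 0 U) ->
    theta_redex (Mu (Named 0 U)) ->
    not_before_end theta_redex (Mu M) (under Body s1) ->
    standard (mu_lower U) s2 N ->
    standard (Mu M) (under Body s1 ++ [] :: s2) N
| std_mu_keep M s1 U s2 V :
    standard M s1 (Named 0 U) ->
    theta_redex (Mu (Named 0 U)) ->
    not_before_end theta_redex (Mu M) (under Body s1) ->
    standard U s2 V ->
    standard (Mu M) (under Body s1 ++ under Body (under Body s2))
      (Mu (Named 0 V))
| std_named a M s N :
    standard M s N -> never rho_redex (Named a M) (under Body s) ->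
    standard (Named a M) (under Body s) (Named a N)
| std_named_rho a M s1 U s2 N :
    standard M s1 (Mu U) ->
    not_before_end rho_redex (Named a M) (under Body s1) ->
    standard (mu_rename0 a U) s2 N ->
    standard (Named a M) (under Body s1 ++ [] :: s2) N
| std_named_keep a M s1 U s2 V :
    standard M s1 (Mu U) ->
    not_before_end rho_redex (Named a M) (under Body s1) ->
    standard U s2 V ->
    standard (Named a M) (under Body s1 ++ under Body (under Body s2))
      (Named a (Mu V))
| std_beta M1 M2 Ms s N :
    standard (apps (subst0 M2 M1) Ms) s N ->
    standard (apps (Lam M1) (M2 :: Ms)) (repeat Fun (length Ms) :: s) N
| std_lam_apps M1 M2 Ms s1 ss N1 Ns :
    standard (Lam M1) s1 (Lam N1) ->
    standard_list (M2 :: Ms) ss Ns ->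
    standard (apps (Lam M1) (M2 :: Ms)) (spine_seq s1 ss) (apps (Lam N1) Ns)
| std_mu_head M1 M2 Ms s N :
    standard (apps (mu_contractum M1 M2) Ms) s N ->
    standard (apps (Mu M1) (M2 :: Ms)) (repeat Fun (length Ms) :: s) N
(* All the steps of [under Body s1] are below the prefix mu, which is thus
   kept. *)
| std_mu_apps M1 M2 Ms s1 ss N1 Ns :
    standard (Mu M1) (under Body s1) (Mu N1) ->
    standard_list (M2 :: Ms) ss Ns ->
    standard (apps (Mu M1) (M2 :: Ms)) (spine_seq (under Body s1) ss)
      (apps (Mu N1) Ns)
| std_var_apps x Ms ss Ns :
    standard_list Ms ss Ns ->
    standard (apps (Var x) Ms) (spine_seq [] ss) (apps (Var x) Ns)
with standard_list : list term -> list redseq -> list term -> Prop :=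
| std_nil : standard_list [] [] []
| std_cons M s N Ms ss Ns :
    standard M s N -> standard_list Ms ss Ns ->
    standard_list (M :: Ms) (s :: ss) (N :: Ns).

(* Main.v *)
Require Import Defs.
From Stdlib Require Import List Arith Lia.
Import ListNotations.

(* A standard sequence that ends in a normal form can leave no redex behind, so
   only the clauses contracting the leftmost redex apply. For the theta- and
   rho-clauses one needs that reduction of lambda-mu-I terms preserves the free
   variables: a term that is not a theta-redex cannot become one by losing a
   mu-variable.

   Maximality: if M -> M' is leftmost and M -> N is any step, then either
   M' ->* N, or N -> N' is leftmost and M' ->+ N' for some N'; at least one
   residual remains in M' since nothing is erased. By induction on the number n
   of leftmost steps from M to the normal form, each step from M strictly
   decreases n, hence n bounds the length of every reduction sequence. *)

Ltac inv H := inversion H; clear H; subst.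
Ltac inv_step := match goal with H : step _ _ _ |- _ => inv H end.
Ltac inv_contract := match goal with H : contract _ _ |- _ => inv H end.
Ltac inv_I := match goal with H : lambda_mu_I _ |- _ => inv H end.

(** * Renaming and substitution *)

(** Equations are asked only at free indices, because maps such as [Nat.pred] in [mu_lower] have the
    intended effect only when index 0 is not free. *)
Lemma ren_comp_free M : forall f g f' g' f'' g'',
  (forall x, lam_free x M -> f (f' x) = f'' x) ->
  (forall a, mu_free a M -> g (g' a) = g'' a) ->
  ren f g (ren f' g' M) = ren f'' g'' M.
Proof.
  induction M; intros; simpl in *.
  - f_equal; auto.
  - f_equal. apply IHM; auto. intros [|x] Hx; simpl; auto.
  - f_equal. apply IHM; auto. intros [|x] Hx; simpl; auto.
  - f_equal; auto.
  - f_equal; auto.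
Qed.

Lemma ren_id_free M : forall f g,
  (forall x, lam_free x M -> f x = x) -> (forall a, mu_free a M -> g a = a) ->
  ren f g M = M.
Proof.
  induction M; intros; simpl in *.
  - f_equal; auto.
  - f_equal. apply IHM; auto. intros [|x] Hx; simpl; auto.
  - f_equal. apply IHM; auto. intros [|x] Hx; simpl; auto.
  - f_equal; auto.
  - f_equal; auto.
Qed.

Lemma ren_ext_free M f g f' g' :
  (forall x, lam_free x M -> f x = f' x) ->
  (forall a, mu_free a M -> g a = g' a) -> ren f g M = ren f' g' M.
Proof.
  (* Inserting an identity renaming turns the left side into a composition. *)
  intros. rewrite <- (ren_id_free M id_ren id_ren) at 1 by reflexivity.
  apply ren_comp_free; auto.
Qed.

Lemma ren_commute M f1 g1 f2 g2 f3 g3 f4 g4 :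
  (forall x, f1 (f2 x) = f3 (f4 x)) -> (forall a, g1 (g2 a) = g3 (g4 a)) ->
  ren f1 g1 (ren f2 g2 M) = ren f3 g3 (ren f4 g4 M).
Proof.
  intros.
  rewrite (ren_comp_free M f1 g1 f2 g2 (fun x => f1 (f2 x)) (fun a => g1 (g2 a))) by auto.
  symmetry. apply ren_comp_free; auto.
Qed.

Lemma ren_lift_lam f g M : ren (up f) g (lift_lam M) = lift_lam (ren f g M).
Proof. apply ren_commute; reflexivity. Qed.

Lemma ren_lift_mu f g M : ren f (up g) (lift_mu M) = lift_mu (ren f g M).
Proof. apply ren_commute; reflexivity. Qed.

(** Serves both [mu_rename0] and [mu_lower], whose renamings differ only at index 0. *)
Lemma ren_mu_cancel g M : (forall a, g (S a) = a) -> ren id_ren g (lift_mu M) = M.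
Proof.
  intros. unfold lift_mu.
  rewrite (ren_comp_free M _ _ _ _ id_ren id_ren) by auto.
  apply ren_id_free; reflexivity.
Qed.

Lemma lam_free_ren M : forall f g x,
  lam_free x (ren f g M) <-> exists y, lam_free y M /\ x = f y.
Proof.
  induction M; intros; simpl.
  - split; [intros ->; eauto | intros (y & -> & ->); auto].
  - rewrite IHM. split.
    + intros ([|y] & Hy & E); simpl in E; [discriminate|].
      injection E as ->. eauto.
    + intros (y & Hy & ->). exists (S y). auto.
  - apply IHM.
  - apply IHM.
  - rewrite IHM1, IHM2. firstorder.
Qed.

Lemma mu_free_ren M : forall f g a,
  mu_free a (ren f g M) <-> exists b, mu_free b M /\ a = g b.
Proof.
  induction M; intros; simpl.
  - firstorder.
  - apply IHM.
  - rewrite IHM. split.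
    + intros ([|y] & Hy & E); simpl in E; [discriminate|].
      injection E as ->. eauto.
    + intros (y & Hy & ->). exists (S y). auto.
  - rewrite IHM. firstorder; subst; eauto.
  - rewrite IHM1, IHM2. firstorder.
Qed.

Lemma mu_free_lift_mu a M : mu_free (S a) (lift_mu M) <-> mu_free a M.
Proof.
  unfold lift_mu. rewrite mu_free_ren. split.
  - intros (b & Hb & E). injection E as ->. auto.
  - eauto.
Qed.

Lemma mu_free_lift_mu_0 M : ~ mu_free 0 (lift_mu M).
Proof. unfold lift_mu. rewrite mu_free_ren. intros (b & _ & E). discriminate. Qed.

Lemma mu_free_lift_lam a M : mu_free a (lift_lam M) <-> mu_free a M.
Proof.
  unfold lift_lam. rewrite mu_free_ren. unfold id_ren. firstorder. subst; auto.
Qed.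

Lemma lam_free_lift_mu x M : lam_free x (lift_mu M) <-> lam_free x M.
Proof.
  unfold lift_mu. rewrite lam_free_ren. unfold id_ren. firstorder. subst; auto.
Qed.

Lemma lam_free_lift_lam x M : lam_free (S x) (lift_lam M) <-> lam_free x M.
Proof.
  unfold lift_lam. rewrite lam_free_ren. split.
  - intros (b & Hb & E). injection E as ->. auto.
  - eauto.
Qed.

(** The separate map [h] on the domain of the substitution lets one statement cover lifting ([S]),
    the beta contractum ([up f]) and pure mu-renamings ([id_ren]). *)
Lemma ren_subst M : forall f g h s t,
  (forall x, ren f g (s x) = t (h x)) ->
  ren f g (subst s M) = subst t (ren h g M).
Proof.
  induction M; intros; simpl; f_equal; auto.
  - apply IHM. intros [|x]; simpl; [reflexivity|].
    rewrite ren_lift_lam, H. reflexivity.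
  - apply IHM. intros x. rewrite ren_lift_mu, H. reflexivity.
Qed.

Lemma subst_id M : forall s, (forall x, s x = Var x) -> subst s M = M.
Proof.
  induction M; intros; simpl; f_equal; auto.
  - apply IHM. intros [|x]; simpl; [reflexivity|]. rewrite H. reflexivity.
  - apply IHM. intros x. rewrite H. reflexivity.
Qed.

Lemma subst_lift_lam s t M :
  (forall x, t (S x) = lift_lam (s x)) ->
  subst t (lift_lam M) = lift_lam (subst s M).
Proof. intros. symmetry. apply ren_subst. intros. symmetry; auto. Qed.

Lemma subst_lift_mu s M :
  subst (fun n => lift_mu (s n)) (lift_mu M) = lift_mu (subst s M).
Proof. symmetry. apply ren_subst. reflexivity. Qed.

Lemma subst_lam_cancel s M :
  (forall x, s (S x) = Var x) -> subst s (lift_lam M) = M.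
Proof.
  intros. unfold lift_lam.
  rewrite <- (ren_subst M id_ren id_ren S Var).
  - rewrite (subst_id M Var) by auto. apply ren_id_free; reflexivity.
  - intros; simpl; auto.
Qed.

Lemma subst_comp M : forall s t r,
  (forall x, subst t (s x) = r x) -> subst t (subst s M) = subst r M.
Proof.
  induction M; intros; simpl; f_equal; auto.
  - apply IHM. intros [|x]; simpl; [reflexivity|].
    rewrite subst_lift_lam with (s := t) by reflexivity. rewrite H. reflexivity.
  - apply IHM. intros x. rewrite subst_lift_mu, H. reflexivity.
Qed.

Lemma lam_free_subst M : forall s x,
  lam_free x (subst s M) <-> exists y, lam_free y M /\ lam_free x (s y).
Proof.
  induction M; intros; simpl.
  - split; [eauto | intros (y & -> & ?); auto].
  - rewrite IHM. split.
    + intros ([|y] & Hy & E); simpl in E; [discriminate|].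
      apply -> lam_free_lift_lam in E. eauto.
    + intros (y & Hy & ?). exists (S y). split; auto.
      apply <- lam_free_lift_lam; auto.
  - rewrite IHM. setoid_rewrite lam_free_lift_mu. reflexivity.
  - apply IHM.
  - rewrite IHM1, IHM2. firstorder.
Qed.

Lemma mu_free_subst M : forall s a,
  mu_free a (subst s M) <->
  mu_free a M \/ exists y, lam_free y M /\ mu_free a (s y).
Proof.
  induction M; intros; simpl.
  - split; [eauto | intros [[]|(y & -> & ?)]; auto].
  - rewrite IHM. split; (intros [?|H]; [auto|right]).
    + destruct H as ([|y] & Hy & E); simpl in E; [destruct E|].
      apply -> mu_free_lift_lam in E. eauto.
    + destruct H as (y & Hy & E). exists (S y). split; auto.
      apply <- mu_free_lift_lam; auto.
  - rewrite IHM. setoid_rewrite mu_free_lift_mu. reflexivity.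
  - rewrite IHM. tauto.
  - rewrite IHM1, IHM2. firstorder.
Qed.

(** * Structural substitution *)

(** If [g] sent another free name to [g a], the substitution on the right would also act on the
    subterms carrying that name. *)
Lemma ren_mu_subst M : forall f g a N,
  (forall b, mu_free b M -> g b = g a -> b = a) ->
  ren f g (mu_subst a N M) = mu_subst (g a) (ren f g N) (ren f g M).
Proof.
  induction M; intros; simpl in *.
  - reflexivity.
  - f_equal. rewrite IHM by auto. rewrite ren_lift_lam. reflexivity.
  - f_equal. rewrite IHM.
    + rewrite ren_lift_mu. reflexivity.
    + intros [|b] Hb; simpl; [discriminate|]. intros E; injection E; auto.
  - destruct (Nat.eqb_spec n a) as [->|Hn].
    + rewrite Nat.eqb_refl. simpl. rewrite IHM by auto. reflexivity.
    + destruct (Nat.eqb_spec (g n) (g a)) as [E|_]; [destruct Hn; auto|].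
      simpl. rewrite IHM by auto. reflexivity.
  - rewrite IHM1, IHM2 by auto. reflexivity.
Qed.

Lemma mu_subst_fresh M : forall a N, ~ mu_free a M -> mu_subst a N M = M.
Proof.
  induction M; intros; simpl in *.
  - reflexivity.
  - f_equal; auto.
  - f_equal; auto.
  - destruct (Nat.eqb_spec n a) as [->|Hn]; [tauto|]. f_equal; auto.
  - f_equal; auto.
Qed.

Lemma mu_subst_lift_lam a N M :
  mu_subst a (lift_lam N) (lift_lam M) = lift_lam (mu_subst a N M).
Proof. symmetry. apply (ren_mu_subst M S id_ren). auto. Qed.

Lemma mu_subst_lift_mu a N M :
  mu_subst (S a) (lift_mu N) (lift_mu M) = lift_mu (mu_subst a N M).
Proof. symmetry. apply (ren_mu_subst M id_ren S). auto. Qed.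

(** [P'] is [P] as seen before [t] is applied. Two instances matter: [s] and [t] instantiate index 0
    and [P'] is a lifted [P]; or [s] and [t] coincide and their values do not contain [a]. *)
Lemma mu_subst_subst M : forall a P P' s t,
  (forall x, mu_subst a P (s x) = t x) -> subst t P' = P ->
  mu_subst a P (subst s M) = subst t (mu_subst a P' M).
Proof.
  induction M; intros a P P' s t Hs HP; simpl.
  - auto.
  - f_equal. apply IHM.
    + intros [|x]; simpl; [reflexivity|]. rewrite mu_subst_lift_lam, Hs. reflexivity.
    + rewrite subst_lift_lam with (s := t) by reflexivity. rewrite HP. reflexivity.
  - f_equal. apply IHM.
    + intros x. rewrite mu_subst_lift_mu, Hs. reflexivity.
    + rewrite subst_lift_mu, HP. reflexivity.
  - destruct (n =? a); simpl; erewrite IHM by eauto; rewrite ?HP; reflexivity.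
  - f_equal; auto.
Qed.

(** The substitution lemma for structural substitution. On the right the copies of [P] are inserted
    first and then traversed by the substitution for [b]; freshness of [b] keeps them intact. *)
Lemma mu_subst_comm M : forall a b P Q,
  b <> a -> ~ mu_free b P ->
  mu_subst a P (mu_subst b Q M) = mu_subst b (mu_subst a P Q) (mu_subst a P M).
Proof.
  induction M; intros a b P Q Hab HP; simpl.
  - reflexivity.
  - f_equal. rewrite IHM, mu_subst_lift_lam; auto. rewrite mu_free_lift_lam; auto.
  - f_equal. rewrite IHM, mu_subst_lift_mu; auto. rewrite mu_free_lift_mu; auto.
  - destruct (Nat.eqb_spec n b) as [->|Hn].
    + destruct (Nat.eqb_spec b a) as [->|_]; [tauto|]. simpl.
      rewrite Nat.eqb_refl. destruct (Nat.eqb_spec b a) as [->|_]; [tauto|].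
      rewrite IHM by auto. reflexivity.
    + destruct (Nat.eqb_spec n a) as [->|Hn']; simpl.
      * rewrite Nat.eqb_refl. destruct (Nat.eqb_spec a b) as [->|_]; [tauto|].
        rewrite IHM by auto. rewrite (mu_subst_fresh P) by auto. reflexivity.
      * destruct (Nat.eqb_spec n a) as [->|_]; [tauto|].
        destruct (Nat.eqb_spec n b) as [->|_]; [tauto|].
        rewrite IHM by auto. reflexivity.
  - f_equal; auto.
Qed.

(** A rho-step identifies two names, so both must receive [P] beforehand. The outer substitution,
    for [a1], traverses the copies of [P] already inserted at [a2], hence the freshness
    condition. *)
Lemma ren_mu_subst_merge M : forall f g a1 a2 P,
  g a1 = g a2 -> a1 <> a2 ->
  (forall b, g b = g a2 -> b = a1 \/ b = a2) -> ~ mu_free a1 P ->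
  ren f g (mu_subst a1 P (mu_subst a2 P M)) =
  mu_subst (g a2) (ren f g P) (ren f g M).
Proof.
  induction M; intros f g a1 a2 P H12 Hn Hg HP; simpl.
  - reflexivity.
  - f_equal. rewrite IHM; auto.
    + rewrite ren_lift_lam. reflexivity.
    + rewrite mu_free_lift_lam; auto.
  - f_equal. rewrite IHM; auto.
    + rewrite ren_lift_mu. reflexivity.
    + simpl; auto.
    + intros [|b] E; simpl in E; [discriminate|]. injection E as E.
      destruct (Hg b E); auto.
    + rewrite mu_free_lift_mu; auto.
  - destruct (Nat.eqb_spec n a2) as [->|H2].
    + rewrite Nat.eqb_refl. simpl.
      destruct (Nat.eqb_spec a2 a1) as [->|_]; [tauto|]. simpl.
      rewrite IHM by auto. rewrite (mu_subst_fresh P) by auto. reflexivity.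
    + simpl. destruct (Nat.eqb_spec n a1) as [->|H1].
      * rewrite H12, Nat.eqb_refl. simpl. rewrite IHM, H12 by auto. reflexivity.
      * destruct (Nat.eqb_spec (g n) (g a2)) as [E|_].
        { destruct (Hg n E); tauto. }
        simpl. rewrite IHM by auto. reflexivity.
  - f_equal; auto.
Qed.

Lemma lam_free_mu_subst M : forall a N x,
  lam_free x (mu_subst a N M) <-> lam_free x M \/ mu_free a M /\ lam_free x N.
Proof.
  induction M; intros; simpl.
  - tauto.
  - rewrite IHM, lam_free_lift_lam. tauto.
  - rewrite IHM, lam_free_lift_mu. tauto.
  - destruct (Nat.eqb_spec n a); simpl; rewrite IHM; intuition congruence.
  - rewrite IHM1, IHM2. tauto.
Qed.

(** No name is lost, not even [a], because [alpha]U becomes [alpha](U N). *)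
Lemma mu_free_mu_subst M : forall a N b,
  mu_free b (mu_subst a N M) <-> mu_free b M \/ mu_free a M /\ mu_free b N.
Proof.
  induction M; intros; simpl.
  - tauto.
  - rewrite IHM, mu_free_lift_lam. tauto.
  - rewrite IHM, mu_free_lift_mu. tauto.
  - destruct (Nat.eqb_spec n a); simpl; rewrite IHM; intuition congruence.
  - rewrite IHM1, IHM2. tauto.
Qed.

(** * Reduction sequences *)

Lemma reduces_app M s N s' P :
  reduces M s N -> reduces N s' P -> reduces M (s ++ s') P.
Proof. induction 1; simpl; eauto using reduces. Qed.

(* [k = 0] gives [M ->* N] and [k = 1] gives [M ->+ N], so that one congruence
   lemma per constructor serves both. *)
Definition reduces_ge (k : nat) (M N : term) : Prop :=
  exists s, reduces M s N /\ k <= length s.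

Lemma reduces_ge_refl M : reduces_ge 0 M M.
Proof. exists []. split; [constructor | auto]. Qed.

Lemma reduces_ge_step p M N : step p M N -> reduces_ge 1 M N.
Proof. exists [p]. split; [eauto using reduces | auto]. Qed.

Lemma reduces_ge_trans j k M N P :
  reduces_ge j M N -> reduces_ge k N P -> reduces_ge (j + k) M P.
Proof.
  intros (s & Hs & Ls) (t & Ht & Lt). exists (s ++ t).
  split; [eauto using reduces_app | rewrite length_app; lia].
Qed.

Lemma reduces_ge_weaken j k M N : reduces_ge k M N -> j <= k -> reduces_ge j M N.
Proof. intros (s & Hs & Ls) ?. exists s. split; [auto | lia]. Qed.

Lemma reduces_ge_map k M N (F : term -> term) :
  (forall P Q p, step p P Q -> reduces_ge 1 (F P) (F Q)) ->
  reduces_ge k M N -> reduces_ge k (F M) (F N).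
Proof.
  intros HF (s & Hs & Ls). apply reduces_ge_weaken with (length s); auto.
  clear Ls. induction Hs.
  - apply reduces_ge_refl.
  - apply (reduces_ge_trans 1) with (F P); eauto.
Qed.

Lemma reduces_ge_lam k M N : reduces_ge k M N -> reduces_ge k (Lam M) (Lam N).
Proof. apply reduces_ge_map. eauto using reduces_ge_step, step. Qed.

Lemma reduces_ge_mu k M N : reduces_ge k M N -> reduces_ge k (Mu M) (Mu N).
Proof. apply reduces_ge_map. eauto using reduces_ge_step, step. Qed.

Lemma reduces_ge_named k a M N :
  reduces_ge k M N -> reduces_ge k (Named a M) (Named a N).
Proof. apply reduces_ge_map. eauto using reduces_ge_step, step. Qed.

Lemma reduces_ge_app j k M N P Q :
  reduces_ge j M N -> reduces_ge k P Q -> reduces_ge (j + k) (App M P) (App N Q).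
Proof.
  intros H1 H2. apply reduces_ge_trans with (App N P).
  - revert H1. apply (reduces_ge_map j M N (fun M => App M P)).
    eauto using reduces_ge_step, step.
  - revert H2. apply reduces_ge_map. eauto using reduces_ge_step, step.
Qed.

(** * Compatibility of reduction with renaming and substitution *)

Lemma contract_ren M N f g : contract M N -> contract (ren f g M) (ren f g N).
Proof.
  destruct 1; simpl.
  - unfold subst0.
    erewrite ren_subst with (h := up f); [apply C_beta|].
    intros [|x]; reflexivity.
  - unfold mu_contractum. simpl.
    rewrite ren_mu_subst, ren_lift_mu; [apply C_mu|].
    intros [|b] _ E; [auto | discriminate].
  - unfold mu_rename0. rewrite (ren_commute _ f g _ _ id_ren
      (fun n => match n with 0 => g a | S n => n end) f (up g)); [apply C_rho | auto |].
    intros [|b]; reflexivity.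
  - assert (HM : ~ mu_free 0 (ren f (up g) M)).
    { rewrite mu_free_ren. intros ([|b] & Hb & E); [auto | discriminate]. }
    replace (ren f g (mu_lower M)) with (mu_lower (ren f (up g) M)); [apply C_theta; auto|].
    unfold mu_lower.
    rewrite (ren_comp_free M f g _ _ f (fun n => g (pred n))) by auto.
    apply ren_comp_free; auto. intros [|b] Hb; [tauto | reflexivity].
Qed.

Lemma step_ren p M N : step p M N -> forall f g, step p (ren f g M) (ren f g N).
Proof. induction 1; intros; simpl; eauto using step, contract_ren. Qed.

Lemma reduces_ge_ren k f g M N :
  reduces_ge k M N -> reduces_ge k (ren f g M) (ren f g N).
Proof. apply reduces_ge_map. eauto using reduces_ge_step, step_ren. Qed.

Lemma contract_subst M N s : contract M N -> contract (subst s M) (subst s N).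
Proof.
  destruct 1; simpl.
  - unfold subst0.
    replace (subst s (subst _ M)) with (subst0 (subst s N) (subst (up_subst s) M)); [apply C_beta|].
    unfold subst0. erewrite !subst_comp; [reflexivity | reflexivity |].
    intros [|x]; simpl; [reflexivity|]. apply subst_lam_cancel. reflexivity.
  - unfold mu_contractum. simpl.
    (* The values of the lifted substitution do not contain the name 0, so the structural
       substitution leaves them unchanged. *)
    erewrite <- mu_subst_subst; [| intros; apply mu_subst_fresh, mu_free_lift_mu_0 | reflexivity].
    rewrite subst_lift_mu. apply C_mu.
  - unfold mu_rename0.
    erewrite <- ren_subst; [apply C_rho|]. intros x. apply ren_mu_cancel. reflexivity.
  - unfold mu_lower.
    erewrite <- ren_subst; [apply C_theta|].
    + rewrite mu_free_subst. intros [?|(y & _ & Hy)]; [tauto|].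
      apply mu_free_lift_mu_0 in Hy. auto.
    + intros x. apply ren_mu_cancel. reflexivity.
Qed.

Lemma step_subst p M N : step p M N -> forall s, step p (subst s M) (subst s N).
Proof. induction 1; intros; simpl; eauto using step, contract_subst. Qed.

(* A rho-redex [alpha]mu beta.M on the substituted variable yields a mu-redex
   followed by a rho-redex. *)
Lemma contract_mu_subst a P M N :
  contract M N -> reduces_ge 1 (mu_subst a P M) (mu_subst a P N).
Proof.
  destruct 1; simpl.
  - unfold subst0. erewrite mu_subst_subst.
    + eapply reduces_ge_step, S_root, C_beta.
    + intros [|x]; reflexivity.
    + apply subst_lam_cancel. reflexivity.
  - unfold mu_contractum. simpl.
    rewrite mu_subst_comm, mu_subst_lift_mu; [| discriminate | apply mu_free_lift_mu_0].
    eapply reduces_ge_step, S_root, C_mu.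
  - destruct (Nat.eqb_spec a0 a) as [->|Hn].
    + apply reduces_ge_weaken with 2; [|auto].
      eapply (reduces_ge_trans 1 1).
      * eapply reduces_ge_step, S_named, S_root, C_mu.
      * unfold mu_contractum. 
        (* The substitution at 0 comes from the mu-redex just contracted; renaming 0 to [a] merges
           it with the one at [S a]. *)
        replace (mu_subst a P (mu_rename0 a M)) with
          (mu_rename0 a (mu_subst 0 (lift_mu P) (mu_subst (S a) (lift_mu P) M))).
        { eapply reduces_ge_step, S_root, C_rho. }
        unfold mu_rename0. rewrite ren_mu_subst_merge; auto.
        -- rewrite ren_mu_cancel by reflexivity. reflexivity.
        -- intros [|b]; auto.
        -- apply mu_free_lift_mu_0.
    + replace (mu_subst a P (mu_rename0 a0 M)) with
        (mu_rename0 a0 (mu_subst (S a) (lift_mu P) M)).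
      { eapply reduces_ge_step, S_root, C_rho. }
      unfold mu_rename0. rewrite ren_mu_subst.
      * rewrite ren_mu_cancel by reflexivity. reflexivity.
      * intros [|b] _ E; [tauto | auto].
  - replace (mu_subst a P (mu_lower M)) with
      (mu_lower (mu_subst (S a) (lift_mu P) M)).
    + eapply reduces_ge_step, S_root, C_theta.
      rewrite mu_free_mu_subst. intros [?|[_ H0]]; [tauto|].
      apply mu_free_lift_mu_0 in H0. auto.
    + unfold mu_lower. rewrite ren_mu_subst.
      * rewrite ren_mu_cancel by reflexivity. reflexivity.
      * intros [|b] Hb E; [tauto | simpl in E; auto].
Qed.

Lemma step_mu_subst p M N :
  step p M N -> forall a P, reduces_ge 1 (mu_subst a P M) (mu_subst a P N).
Proof.
  induction 1; intros; simpl.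
  - apply contract_mu_subst; auto.
  - apply reduces_ge_lam; auto.
  - apply reduces_ge_mu; auto.
  - destruct (a =? a0).
    + apply reduces_ge_named, (reduces_ge_app 1 0); auto using reduces_ge_refl.
    + apply reduces_ge_named; auto.
  - apply (reduces_ge_app 1 0); auto using reduces_ge_refl.
  - apply (reduces_ge_app 0 1); auto using reduces_ge_refl.
Qed.

(** * Reduction of the substituted terms *)

Lemma reduces_subst_arg0 M : forall s t,
  (forall x, reduces_ge 0 (s x) (t x)) -> reduces_ge 0 (subst s M) (subst t M).
Proof.
  induction M; intros; simpl.
  - auto.
  - apply reduces_ge_lam, IHM. intros [|x]; simpl; [apply reduces_ge_refl|].
    apply reduces_ge_ren; auto.
  - apply reduces_ge_mu, IHM. intros x. apply reduces_ge_ren; auto.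
  - apply reduces_ge_named; auto.
  - apply (reduces_ge_app 0 0); auto.
Qed.

(** A free occurrence of [x] carries a copy of [s x], where at least one step is performed. This is
    how a redex in the argument of a beta-redex keeps a residual. *)
Lemma reduces_subst_arg M : forall s t x,
  (forall x, reduces_ge 0 (s x) (t x)) ->
  lam_free x M -> reduces_ge 1 (s x) (t x) -> reduces_ge 1 (subst s M) (subst t M).
Proof.
  induction M; intros s t x Hst Hx Hs; simpl in *.
  - subst; auto.
  - apply reduces_ge_lam. apply IHM with (S x); auto.
    + intros [|y]; simpl; [apply reduces_ge_refl|]. apply reduces_ge_ren; auto.
    + apply reduces_ge_ren; auto.
  - apply reduces_ge_mu. apply IHM with x; auto.
    + intros y. apply reduces_ge_ren; auto.
    + apply reduces_ge_ren; auto.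
  - apply reduces_ge_named; eauto.
  - destruct Hx.
    + apply (reduces_ge_app 1 0); eauto using reduces_subst_arg0.
    + apply (reduces_ge_app 0 1); eauto using reduces_subst_arg0.
Qed.

Lemma reduces_mu_subst_arg0 M : forall a P Q,
  reduces_ge 0 P Q -> reduces_ge 0 (mu_subst a P M) (mu_subst a Q M).
Proof.
  induction M; intros; simpl.
  - apply reduces_ge_refl.
  - apply reduces_ge_lam, IHM, reduces_ge_ren; auto.
  - apply reduces_ge_mu, IHM, reduces_ge_ren; auto.
  - destruct (n =? a); apply reduces_ge_named; auto.
    apply (reduces_ge_app 0 0); auto.
  - apply (reduces_ge_app 0 0); auto.
Qed.

(** The same for structural substitution: each free occurrence of [a] receives a copy of the
    argument. *)
Lemma reduces_mu_subst_arg M : forall a P Q,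
  mu_free a M -> reduces_ge 1 P Q ->
  reduces_ge 1 (mu_subst a P M) (mu_subst a Q M).
Proof.
  induction M; intros a P Q Ha HPQ; simpl in *;
    assert (H0 : reduces_ge 0 P Q) by (apply reduces_ge_weaken with 1; auto).
  - tauto.
  - apply reduces_ge_lam, IHM; auto. apply reduces_ge_ren; auto.
  - apply reduces_ge_mu, IHM; auto. apply reduces_ge_ren; auto.
  - destruct (Nat.eqb_spec n a); apply reduces_ge_named.
    + apply (reduces_ge_app 0 1); auto using reduces_mu_subst_arg0.
    + apply IHM; auto. destruct Ha; [congruence | auto].
  - destruct Ha.
    + apply (reduces_ge_app 1 0); auto using reduces_mu_subst_arg0.
    + apply (reduces_ge_app 0 1); auto using reduces_mu_subst_arg0.
Qed.

(** * The lambda-mu-I terms *)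

Lemma lambda_mu_I_ren M : lambda_mu_I M -> forall f g, lambda_mu_I (ren f g M).
Proof.
  induction 1; intros; simpl; constructor; auto.
  - apply lam_free_ren. exists 0; auto.
  - apply mu_free_ren. exists 0; auto.
Qed.

Lemma lambda_mu_I_subst M :
  lambda_mu_I M -> forall s, (forall x, lambda_mu_I (s x)) -> lambda_mu_I (subst s M).
Proof.
  induction 1; intros; simpl; auto; constructor; auto.
  - apply IHlambda_mu_I. intros [|x]; simpl; [constructor|].
    apply lambda_mu_I_ren; auto.
  - apply lam_free_subst. exists 0; simpl; auto.
  - apply IHlambda_mu_I. intros x. apply lambda_mu_I_ren; auto.
  - apply mu_free_subst. auto.
Qed.

Lemma lambda_mu_I_mu_subst M :
  lambda_mu_I M -> forall a N, lambda_mu_I N -> lambda_mu_I (mu_subst a N M).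
Proof.
  induction 1; intros b N' HN; simpl.
  - constructor.
  - constructor; auto.
  - destruct (a =? b); repeat constructor; auto.
  - constructor.
    + apply IHlambda_mu_I, lambda_mu_I_ren; auto.
    + apply lam_free_mu_subst; auto.
  - constructor.
    + apply IHlambda_mu_I, lambda_mu_I_ren; auto.
    + apply mu_free_mu_subst; auto.
Qed.

(** An argument would be erased only if the bound variable did not occur, which the lambda-mu-I
    condition excludes. A rho-step merges the bound name into one that is already free, and a
    theta-step drops only the bound name. *)
Lemma contract_lambda_mu_I M N :
  contract M N -> lambda_mu_I M ->
  lambda_mu_I N /\ (forall x, lam_free x N <-> lam_free x M) /\
  (forall a, mu_free a N <-> mu_free a M).
Proof.
  destruct 1; intros HI; simpl.
  - inversion_clear HI as [|? ? HM HN| | |]. inversion_clear HM as [| | |? HM' H0|].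
    split; [|split].
    + apply lambda_mu_I_subst; auto. intros [|x]; [auto | constructor].
    + intros x. unfold subst0. rewrite lam_free_subst. split.
      * intros ([|y] & Hy & E); simpl in E; [auto|]. subst; auto.
      * intros [?|?]; [exists (S x) | exists 0]; simpl; auto.
    + intros x. unfold subst0. rewrite mu_free_subst. split.
      * intros [?|([|y] & Hy & E)]; simpl in *; tauto.
      * intros [?|?]; [auto | right; exists 0; auto].
  - inversion_clear HI as [|? ? HM HN| | |]. inversion_clear HM as [| | | |? HM' H0].
    split; [|split].
    + constructor.
      * apply lambda_mu_I_mu_subst; auto. apply lambda_mu_I_ren; auto.
      * apply mu_free_mu_subst; auto.
    + intros x. rewrite lam_free_mu_subst, lam_free_lift_mu. tauto.
    + intros x. rewrite mu_free_mu_subst, mu_free_lift_mu. tauto.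
  - inversion_clear HI as [| |? ? HM| |]. inversion_clear HM as [| | | |? HM' H0].
    split; [|split].
    + apply lambda_mu_I_ren; auto.
    + intros x. unfold mu_rename0. rewrite lam_free_ren. unfold id_ren.
      firstorder. subst; auto.
    + intros x. unfold mu_rename0. rewrite mu_free_ren. split.
      * intros ([|b] & Hb & ->); auto.
      * intros [->|?]; eauto.
  - inversion_clear HI as [| | | |? HM _]. inversion_clear HM as [| |? ? HM'| |].
    split; [|split].
    + apply lambda_mu_I_ren; auto.
    + intros x. unfold mu_lower. rewrite lam_free_ren. unfold id_ren.
      firstorder. subst; auto.
    + intros x. unfold mu_lower. rewrite mu_free_ren. split.
      * intros ([|b] & Hb & ->); [tauto | auto].
      * intros [?|?]; [discriminate | eauto].
Qed.

(** Preservation of the free variables is proved simultaneously because it restores the occurrence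
    condition at every enclosing binder. *)
Lemma step_lambda_mu_I p M N :
  step p M N -> lambda_mu_I M ->
  lambda_mu_I N /\ (forall x, lam_free x N <-> lam_free x M) /\
  (forall a, mu_free a N <-> mu_free a M).
Proof.
  induction 1; intros HI.
  - apply contract_lambda_mu_I; auto.
  - inversion_clear HI as [| | |? HM H0|]. destruct (IHstep HM) as (H1 & H2 & H3).
    split; [constructor; [auto | apply H2; auto]|]. simpl; split; auto.
  - inversion_clear HI as [| | | |? HM H0]. destruct (IHstep HM) as (H1 & H2 & H3).
    split; [constructor; [auto | apply H3; auto]|]. simpl; split; auto.
  - inversion_clear HI as [| |? ? HM| |]. destruct (IHstep HM) as (H1 & H2 & H3).
    split; [constructor; auto|]. simpl; split; [auto|].
    intros b. rewrite H3. reflexivity.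
  - inversion_clear HI as [|? ? HM HP| | |]. destruct (IHstep HM) as (H1 & H2 & H3).
    split; [constructor; auto|]. simpl; split; intros x; rewrite ?H2, ?H3; reflexivity.
  - inversion_clear HI as [|? ? HP HM| | |]. destruct (IHstep HM) as (H1 & H2 & H3).
    split; [constructor; auto|]. simpl; split; intros x; rewrite ?H2, ?H3; reflexivity.
Qed.

Lemma reduces_lambda_mu_I M s N :
  reduces M s N -> lambda_mu_I M ->
  lambda_mu_I N /\ (forall a, mu_free a N <-> mu_free a M).
Proof.
  induction 1; intros HI; [split; [auto | reflexivity]|].
  destruct (step_lambda_mu_I _ _ _ H HI) as (HP & _ & HF).
  destruct (IHreduces HP) as (HN & HF'). split; [auto|].
  intros a. rewrite HF', HF. reflexivity.
Qed.

(** * Leftmost reductions are the longest *)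

Lemma apps_snoc M Ms P : apps M (Ms ++ [P]) = App (apps M Ms) P.
Proof. unfold apps. apply fold_left_app. Qed.

Fixpoint var_headed (M : term) : Prop :=
  match M with Var _ => True | App M _ => var_headed M | _ => False end.

(** A form of [lr] without positions or spines, whose inductions follow binary application. [ls_fun]
    descends to a head redex, or to an earlier argument under a head variable. *)
Inductive left_step : term -> term -> Prop :=
| ls_lam M M' : left_step M M' -> left_step (Lam M) (Lam M')
| ls_theta U : ~ mu_free 0 U -> left_step (Mu (Named 0 U)) (mu_lower U)
| ls_mu M M' :
    ~ theta_redex (Mu M) -> left_step M M' -> left_step (Mu M) (Mu M')
| ls_rho a U : left_step (Named a (Mu U)) (mu_rename0 a U)
| ls_named a M M' :
    ~ rho_redex (Named a M) -> left_step M M' ->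
    left_step (Named a M) (Named a M')
| ls_beta M N : left_step (App (Lam M) N) (subst0 N M)
| ls_mu_app M N : left_step (App (Mu M) N) (mu_contractum M N)
| ls_fun A B M' P :
    left_step (App A B) M' -> left_step (App (App A B) P) (App M' P)
| ls_arg M P P' :
    NF M -> var_headed M -> left_step P P' -> left_step (App M P) (App M P').

Lemma apps_var_NF x Ms : Forall NF Ms -> NF (apps (Var x) Ms).
Proof.
  (* [apps] nests to the left, so the last argument belongs to the outermost application. *)
  induction Ms as [|P Ms IH] using rev_ind; intros H q N Hs.
  - inv Hs. inv H0.
  - apply Forall_app in H as [H1 H2]. inv H2. rewrite apps_snoc in Hs.
    inv Hs.
    + destruct Ms as [|? Ms _] using rev_ind; [inv H|].
      rewrite apps_snoc in H. inv H.
    + eapply IH; eauto.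
    + eapply H3; eauto.
Qed.

Lemma apps_var_headed M Ms : var_headed M -> var_headed (apps M Ms).
Proof. revert M. induction Ms; simpl; auto. Qed.

Lemma lr_left_step M p : lr M p -> forall M', step p M M' -> left_step M M'.
Proof.
  (* Both kinds of head redex are handled by one induction on the trailing arguments, each of which
     adds one [Fun] to the position. *)
  assert (Hhead : forall A B C Ps,
    (forall C, contract (App A B) C -> left_step (App A B) C) ->
    step (repeat Fun (length Ps)) (apps (App A B) Ps) C ->
    left_step (apps (App A B) Ps) C).
  { intros A B C Ps HR. revert C.
    induction Ps as [|P Ps IH] using rev_ind; intros C Hs.
    - inv Hs. auto.
    - rewrite length_app, Nat.add_comm in Hs. simpl in Hs.
      rewrite apps_snoc in *. inv Hs. apply IH in H3.
      (* [ls_fun] requires the function part to be visibly an application. *)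
      destruct Ps as [|? Ps _] using rev_ind; [constructor; auto|].
      rewrite apps_snoc in *. constructor; auto. }
  induction 1; intros M' Hs.
  - inv Hs. constructor; auto.
  - destruct H as (U & E & HU). injection E as ->. inv Hs. inv H. constructor; auto.
  - inv Hs. constructor; auto.
  - destruct H as (b & U & E). injection E as <- ->. inv Hs. inv H. constructor.
  - inv Hs. constructor; auto.
  - apply Hhead; auto. intros C HC; inv HC. constructor.
  - apply Hhead; auto. intros C HC; inv HC. constructor.
  - assert (E : forall Ps P, Ms ++ M :: Ps ++ [P] = (Ms ++ M :: Ps) ++ [P])
      by (intros; rewrite <- app_assoc; reflexivity).
    revert M' Hs. induction Ms' as [|P Ms' IH] using rev_ind; intros M' Hs.
    + simpl in Hs. rewrite apps_snoc in *. inv Hs. constructor; auto.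
      * apply apps_var_NF; auto.
      * apply apps_var_headed; simpl; auto.
    + rewrite length_app, Nat.add_comm in Hs. simpl in Hs.
      rewrite E, apps_snoc in *. inv Hs. apply IH in H6.
      destruct Ms' as [|? Ms' _] using rev_ind.
      * rewrite apps_snoc in *. constructor; auto.
      * rewrite E, apps_snoc in *. constructor; auto.
Qed.

(* The second alternative excludes the root position, so that a non-leftmost
   step keeps the outermost constructor and does not turn its context into a
   theta- or rho-redex. The first one also covers the critical pairs, such as
   the theta-redex in [(mu alpha.[alpha]M) P]. *)
Lemma left_step_diagram M M' :
  left_step M M' -> lambda_mu_I M -> forall q N, step q M N ->
  reduces_ge 0 M' N \/
  (q <> [] /\ exists N', left_step N N' /\ reduces_ge 1 M' N').
Proof.
  induction 1; intros HI q N0 Hq.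
  - inv HI. inv Hq; [inv H0|].
    edestruct IHleft_step as [?|(_ & N' & ? & ?)]; [eassumption | eassumption | |].
    + left. apply reduces_ge_lam; auto.
    + right. split; [discriminate|]. eauto using left_step, reduces_ge_lam.
  - inv HI. inv H1. inv Hq.
    + inv H0. left. apply reduces_ge_refl.
    + inv H4.
      * inv H0. left.
        (* Critical pair mu a.[a]mu b.M. The two renamings differ only at the index of a, which is
           not free in mu b.M. *)
        replace (Mu (mu_rename0 0 M)) with (mu_lower (Mu M)); [apply reduces_ge_refl|].
        unfold mu_lower, mu_rename0. simpl. f_equal.
        apply ren_ext_free; [reflexivity|].
        intros [|[|b]] Hb; simpl in *; tauto.
      * right. split; [discriminate|]. exists (mu_lower N0). split.
        -- constructor. edestruct step_lambda_mu_I as (_ & _ & HF); [eassumption | eassumption |].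
           rewrite HF. auto.
        -- apply reduces_ge_ren. eauto using reduces_ge_step.
  - inv HI. inv Hq.
    { inv H1. destruct H. unfold theta_redex, rho_redex; eauto. }
    edestruct IHleft_step as [?|(Hp & N' & ? & ?)]; [eassumption | eassumption | |].
    + left. apply reduces_ge_mu; auto.
    + right. split; [discriminate|]. exists (Mu N').
      split; [|apply reduces_ge_mu; auto]. constructor; auto.
      (* A step below the root of the body keeps its outer name and its free names, so a theta-redex
         after the step was one before. *)
      intros (U & E & HU). injection E as ->. apply H.
      inv H5; [tauto|]. inv H2. eexists; split; [reflexivity|].
      edestruct step_lambda_mu_I as (_ & _ & HF); [eassumption | eassumption |]. rewrite <- HF. auto.
  - inv HI. inv_I. inv Hq.
    + inv_contract. left. apply reduces_ge_refl.
    + inv_step.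
      * inv_contract. left.
        (* Critical pair [a]mu b.[b]M with b not free in M: renaming b to a and dropping b give the
           same term. *)
        replace (mu_rename0 a (Named 0 M)) with (Named a (mu_lower M)); [apply reduces_ge_refl|].
        unfold mu_rename0, mu_lower. simpl. f_equal.
        apply ren_ext_free; [reflexivity|]. intros [|b] Hb; tauto.
      * right. split; [discriminate|]. eexists.
        split; [constructor|]. apply reduces_ge_ren. eauto using reduces_ge_step.
  - inv HI. inv Hq.
    { inv_contract. destruct H. unfold rho_redex; eauto. }
    edestruct IHleft_step as [?|(Hp & N' & ? & ?)]; [eassumption | eassumption | |].
    + left. apply reduces_ge_named; auto.
    + right. split; [discriminate|]. exists (Named a N').
      split; [|apply reduces_ge_named; auto]. constructor; auto.
      intros (b & U & E). injection E as <- ->. apply H.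
      inv_step; [tauto|]. unfold rho_redex; eauto.
  - inv HI. match goal with H : lambda_mu_I (Lam _) |- _ => inv H end. inv Hq.
    + inv_contract. left. apply reduces_ge_refl.
    + inv_step; [inv_contract|]. right. split; [discriminate|].
      eexists; split; [constructor|]. eapply reduces_ge_step, step_subst; eauto.
    + right. split; [discriminate|]. eexists; split; [constructor|].
      (* The bound variable occurs in the body, so the argument is not erased. *)
      apply reduces_subst_arg with 0; eauto using reduces_ge_step.
      intros [|x]; [|apply reduces_ge_refl].
      apply reduces_ge_weaken with 1; eauto using reduces_ge_step.
  - inv HI. match goal with H : lambda_mu_I (Mu _) |- _ => inv H end. inv Hq.
    + inv_contract. left. apply reduces_ge_refl.
    + inv_step.
      (* For (mu a.[a]M) N the mu-contractum is mu a.[a](M N), and one theta-step leads from it to M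
         N. *)
      * inv_contract. left. apply reduces_ge_weaken with 1; [|auto].
        unfold mu_contractum. simpl. rewrite mu_subst_fresh by auto.
        replace (App (mu_lower M0) N) with (mu_lower (App M0 (lift_mu N))).
        -- eapply reduces_ge_step, S_root, C_theta. simpl.
           intros [?|HP]; [tauto | exact (mu_free_lift_mu_0 _ HP)].
        -- unfold mu_lower. simpl. rewrite ren_mu_cancel; reflexivity.
      * right. split; [discriminate|].
        eexists; split; [constructor|]. eapply reduces_ge_mu, step_mu_subst; eauto.
    + right. split; [discriminate|]. eexists; split; [constructor|].
      apply reduces_ge_mu, reduces_mu_subst_arg; auto.
      apply reduces_ge_ren. eauto using reduces_ge_step.
  - inv HI. inv Hq; [inv_contract| |].
    + edestruct IHleft_step as [?|(Hp & N' & ? & ?)]; [eassumption | eassumption | |].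
      * left. apply (reduces_ge_app 0 0); auto using reduces_ge_refl.
      * right. split; [discriminate|]. exists (App N' P). split.
        (* The step avoids the root, so the function part is still an application. *)
        -- inv_step; [tauto| |]; constructor; auto.
        -- apply (reduces_ge_app 1 0); auto using reduces_ge_refl.
    + right. split; [discriminate|]. exists (App M' N). split.
      * constructor; auto.
      * apply (reduces_ge_app 0 1); eauto using reduces_ge_refl, reduces_ge_step.
  - inv HI. inv Hq.
    + inv_contract; contradiction.
    + edestruct H; eassumption.
    + edestruct IHleft_step as [?|(Hp & N' & ? & ?)]; [eassumption | eassumption | |].
      * left. apply (reduces_ge_app 0 0); auto using reduces_ge_refl.
      * right. split; [discriminate|]. exists (App M N'). split.
        -- constructor; auto.
        -- apply (reduces_ge_app 0 1); auto using reduces_ge_refl.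
Qed.

(** * Counting leftmost steps to the normal form *)

Inductive left_normalizes : nat -> term -> Prop :=
| ln_NF M : NF M -> left_normalizes 0 M
| ln_step n M M' :
    left_step M M' -> left_normalizes n M' -> left_normalizes (S n) M.

Lemma leftmost_left_normalizes M s N :
  leftmost_reduction M s N -> NF N -> left_normalizes (length s) M.
Proof.
  induction 1; intros HN; simpl.
  - constructor; auto.
  - econstructor; eauto using lr_left_step.
Qed.

Lemma left_step_I M M' : left_step M M' -> lambda_mu_I M -> lambda_mu_I M'.
Proof.
  assert (HC : forall M N, contract M N -> lambda_mu_I M -> lambda_mu_I N)
    by (intros; eapply contract_lambda_mu_I; eauto).
  enough (left_step M M' -> exists p, step p M M').
  { intros Hl. destruct (H Hl) as (p & Hp). eapply step_lambda_mu_I; eauto. }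
  induction 1; eauto using step, contract;
    destruct IHleft_step; eauto using step, contract.
Qed.

Lemma left_normalizes_reduces n : forall M s N,
  lambda_mu_I M -> left_normalizes n M -> reduces M s N ->
  exists m, m + length s <= n /\ left_normalizes m N.
Proof.
  induction n as [n IH] using (well_founded_induction lt_wf).
  intros M s N HI Hn Hs.
  inversion Hs as [|? p P s' ? Hp Hs']; subst; clear Hs; [exists n; simpl; split; [lia | auto]|].
  (* One arbitrary step strictly lowers the count. The induction hypothesis is applied to the
     leftmost reduct, along the whole sequence given by the diagram. *)
  assert (exists m, m < n /\ left_normalizes m P) as (m & Hm & HP).
  { inversion Hn as [? HM|n' ? M' HM Hn']; subst; clear Hn; [destruct (HM _ _ Hp)|].
    destruct (left_step_diagram _ _ HM HI _ _ Hp) as [(t & Ht & _)|(_ & P' & HP & t & Ht & Lt)].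
    - destruct (IH n' (Nat.lt_succ_diag_r n') _ _ _ (left_step_I _ _ HM HI) Hn' Ht) as (m & ? & ?).
      exists m. split; [lia | auto].
    (* [t] is nonempty, so [m < n']; this compensates for the extra leftmost step from [P] to
       [P']. *)
    - destruct (IH n' (Nat.lt_succ_diag_r n') _ _ _ (left_step_I _ _ HM HI) Hn' Ht) as (m & ? & ?).
      exists (S m). split; [lia | econstructor; eauto]. }
  destruct (step_lambda_mu_I _ _ _ Hp HI) as (HIP & _).
  destruct (IH m Hm _ _ _ HIP HP Hs') as (k & ? & ?).
  exists k. simpl. split; [lia | auto].
Qed.

Lemma leftmost_maximal M s N s' N' :
  lambda_mu_I M -> leftmost_reduction M s N -> NF N -> reduces M s' N' ->
  length s' <= length s.
Proof.
  intros HI Hl HN Hs'.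
  destruct (left_normalizes_reduces _ _ _ _ HI (leftmost_left_normalizes _ _ _ Hl HN) Hs')
    as (m & ? & _).
  lia.
Qed.

(** * Standard reductions to the normal form are leftmost *)

Scheme standard_mut := Induction for standard Sort Prop
  with standard_list_mut := Induction for standard_list Sort Prop.
Combined Scheme standard_standard_list_ind from standard_mut, standard_list_mut.

Inductive Forall3 {A B C : Type} (R : A -> B -> C -> Prop) :
  list A -> list B -> list C -> Prop :=
| Forall3_nil : Forall3 R [] [] []
| Forall3_cons a b c la lb lc :
    R a b c -> Forall3 R la lb lc -> Forall3 R (a :: la) (b :: lb) (c :: lc).

(** * Standard sequences as reduction sequences *)

Lemma reduces_under d (F : term -> term) M s N :
  (forall p M N, step p M N -> step (d :: p) (F M) (F N)) ->
  reduces M s N -> reduces (F M) (under d s) (F N).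
Proof. intros HF. induction 1; simpl; eauto using reduces. Qed.

Lemma reduces_spine Ms ss Ns : Forall3 reduces Ms ss Ns -> forall M s N,
  reduces M s N -> reduces (apps M Ms) (spine_seq s ss) (apps N Ns).
Proof.
  induction 1; intros M s N Hs; simpl; [auto|].
  apply IHForall3. apply reduces_app with (App N a).
  - apply (reduces_under Fun (fun M => App M a)); auto using step.
  - apply (reduces_under Arg); auto using step.
Qed.

Lemma step_apps Ms : forall p M N, step p M N ->
  step (repeat Fun (length Ms) ++ p) (apps M Ms) (apps N Ms).
Proof.
  induction Ms as [|P Ms IH] using rev_ind; intros; simpl; auto.
  rewrite !apps_snoc, length_app, Nat.add_comm. simpl. constructor; auto.
Qed.

Lemma contract_apps Ms M N :
  contract M N -> step (repeat Fun (length Ms)) (apps M Ms) (apps N Ms).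
Proof.
  intros. rewrite <- (app_nil_r (repeat _ _)). apply step_apps. constructor; auto.
Qed.

Lemma standard_reduces_mut :
  (forall M s N, standard M s N -> reduces M s N) /\
  (forall Ms ss Ns, standard_list Ms ss Ns -> Forall3 reduces Ms ss Ns).
Proof.
  apply standard_standard_list_ind; intros; try (constructor; auto; fail).
  - apply reduces_under; auto using step.
  - apply reduces_under; auto using step.
  - eapply reduces_app; [apply reduces_under; eauto using step|].
    destruct t as (V & E & HV). injection E as ->.
    econstructor; [do 2 constructor; auto | auto].
  - eapply reduces_app; [apply reduces_under; eauto using step|].
    apply reduces_under; auto using step. apply reduces_under; auto using step.
  - apply reduces_under; auto using step.
  - eapply reduces_app; [apply reduces_under; eauto using step|].
    econstructor; [do 2 constructor | auto].
  - eapply reduces_app; [apply reduces_under; eauto using step|].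
    apply reduces_under; auto using step. apply reduces_under; auto using step.
  - econstructor; [apply (contract_apps Ms (App (Lam M1) M2)); constructor | auto].
  - apply reduces_spine; auto.
  - econstructor; [apply (contract_apps Ms (App (Mu M1) M2)); constructor | auto].
  - apply reduces_spine; auto.
  - apply reduces_spine; [auto | constructor].
Qed.

Lemma standard_reduces M s N : standard M s N -> reduces M s N.
Proof. apply standard_reduces_mut. Qed.

Lemma leftmost_app M s N s' P :
  leftmost_reduction M s N -> leftmost_reduction N s' P ->
  leftmost_reduction M (s ++ s') P.
Proof. induction 1; simpl; eauto using leftmost_reduction. Qed.

(** * Stopping conditions *)

Definition is_mu (M : term) : Prop := exists U, M = Mu U.
Definition theta_body (M : term) : Prop := theta_redex (Mu M).

(* The induction also meets standard sequences that do not end in a normal form: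
   those below a mu (below a name) ending in the first term that makes it a theta-
   (rho-) redex. *)
Inductive stops : term -> redseq -> term -> Prop :=
| stops_NF M s N : NF N -> stops M s N
| stops_first X M s N :
    X = is_mu \/ X = theta_body -> X N -> not_before_end X M s -> stops M s N.

Lemma not_before_end_suffix X M s P t :
  reduces M s P -> not_before_end X M (s ++ t) -> not_before_end X P t.
Proof.
  intros Hs HX t1 p t2 Q -> HQ.
  apply (HX (s ++ t1) p t2); [apply app_assoc | eauto using reduces_app].
Qed.

Lemma stops_suffix M s P t N :
  reduces M s P -> stops M (s ++ t) N -> stops P t N.
Proof.
  intros Hs H. inversion H; subst.
  - apply stops_NF; auto.
  - eapply stops_first; eauto using not_before_end_suffix.
Qed.

Lemma not_before_end_nil X M s : X M -> not_before_end X M s -> s = [].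
Proof.
  intros HM HX. destruct s as [|p s]; [auto|].
  destruct (HX [] p s M); [auto | constructor | auto].
Qed.

Lemma not_before_end_under (X Y : term -> Prop) d F M s :
  (forall p M N, step p M N -> step (d :: p) (F M) (F N)) ->
  (forall M, X M -> Y (F M)) ->
  not_before_end Y (F M) (under d s) -> not_before_end X M s.
Proof.
  intros HF HXY HY s1 p s2 P -> HP HX.
  apply (HY (under d s1) (d :: p) (under d s2) (F P)); auto.
  - unfold under. rewrite map_app. reflexivity.
  - apply reduces_under; auto.
Qed.

(** An application is neither a mu-abstraction nor a named term, so only the normal-form alternative
    is possible. *)
Lemma stops_NF_of_App M s A B : stops M s (App A B) -> NF (App A B).
Proof.
  intros H. inversion H; subst; [auto|].
  destruct H0 as [-> | ->]; [destruct H1 as (? & ?) | destruct H1 as (? & ? & ?)];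
    discriminate.
Qed.

Lemma apps_NF M Ms : NF (apps M Ms) -> NF M.
Proof. intros H p N Hs. eapply H, step_apps, Hs. Qed.

Lemma apps_NF_args Ns : forall M, NF (apps M Ns) -> Forall NF Ns.
Proof.
  induction Ns as [|N Ns IH]; intros M H; constructor.
  - intros p P Hs. eapply (apps_NF (App M N) Ns H (Arg :: p)). constructor; eauto.
  - apply IH with (App M N). auto.
Qed.

(** * Leftmost sequences in contexts *)

Lemma leftmost_lam M s N :
  leftmost_reduction M s N -> leftmost_reduction (Lam M) (under Body s) (Lam N).
Proof. induction 1; simpl; eauto using leftmost_reduction, lr, step. Qed.

(** No step leaves the last term, which may therefore be a theta-redex; this allows the sequence to
    be followed by a theta-step. *)
Lemma leftmost_mu M s N :
  leftmost_reduction M s N -> not_before_end theta_redex (Mu M) (under Body s) ->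
  leftmost_reduction (Mu M) (under Body s) (Mu N).
Proof.
  induction 1; intros HX; simpl; [constructor|].
  econstructor.
  - apply lr_mu; eauto. apply (HX [] (Body :: p) (under Body s)); [auto | constructor].
  - constructor; eauto.
  - apply IHleftmost_reduction.
    apply (not_before_end_suffix theta_redex (Mu M) [Body :: p]); auto.
    eauto using reduces, step.
Qed.

Lemma leftmost_named a M s N :
  leftmost_reduction M s N ->
  not_before_end rho_redex (Named a M) (under Body s) ->
  leftmost_reduction (Named a M) (under Body s) (Named a N).
Proof.
  induction 1; intros HX; simpl; [constructor|].
  econstructor.
  - apply lr_named; eauto. apply (HX [] (Body :: p) (under Body s)); [auto | constructor].
  - constructor; eauto.
  - apply IHleftmost_reduction.
    apply (not_before_end_suffix rho_redex (Named a M) [Body :: p]); auto.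
    eauto using reduces, step.
Qed.

Lemma never_not_before_end X M s : never X M s -> not_before_end X M s.
Proof. intros H s1 p s2 P E. apply (H s1 (p :: s2)); auto. Qed.

(** [spine_seq] nests to the left; this form brings the earliest steps to the front, so that the
    arguments can be treated from left to right. *)
Lemma spine_seq_cat s0 ss :
  spine_seq s0 ss = map (app (repeat Fun (length ss))) s0 ++ spine_seq [] ss.
Proof.
  revert s0. induction ss as [|s ss IH]; intros s0; simpl.
  - rewrite app_nil_r. symmetry. apply map_id.
  - unfold spine_seq in *. simpl. rewrite IH. rewrite (IH (under Arg s)).
    rewrite map_app, <- app_assoc. f_equal. unfold under. rewrite map_map.
    apply map_ext. intros p.
    change (Fun :: p) with ([Fun] ++ p). rewrite app_assoc, <- repeat_cons. reflexivity.
Qed.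

Lemma leftmost_var_arg x Ps Ms M s N :
  Forall NF Ps -> leftmost_reduction M s N ->
  leftmost_reduction (apps (Var x) (Ps ++ M :: Ms))
    (map (app (repeat Fun (length Ms))) (under Arg s))
    (apps (Var x) (Ps ++ N :: Ms)).
Proof.
  intros HP. induction 1; simpl; [constructor|].
  econstructor; [| |apply IHleftmost_reduction].
  - apply lr_head_var; auto. intros HM. eapply HM; eauto.
  - unfold apps. rewrite !fold_left_app. simpl. apply step_apps. constructor; auto.
Qed.

(** [Ps] accumulates the arguments already normalized, as [lr_head_var] demands normal forms to the
    left of the active argument. *)
Lemma leftmost_var_apps x Ms ss Ns :
  Forall3 leftmost_reduction Ms ss Ns -> Forall NF Ns ->
  forall Ps, Forall NF Ps ->
  leftmost_reduction (apps (Var x) (Ps ++ Ms)) (spine_seq [] ss)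
    (apps (Var x) (Ps ++ Ns)).
Proof.
  induction 1 as [|M s N Ms ss Ns HM HMs IH]; intros HN Ps HP.
  - constructor.
  - inversion_clear HN.
    change (spine_seq [] (s :: ss)) with (spine_seq (under Arg s) ss).
    rewrite spine_seq_cat. eapply leftmost_app.
    + replace (length ss) with (length Ms) by (clear - HMs; induction HMs; simpl; auto).
      apply leftmost_var_arg; eauto.
    + replace (Ps ++ N :: Ms) with ((Ps ++ [N]) ++ Ms) by (rewrite <- app_assoc; auto).
      replace (Ps ++ N :: Ns) with ((Ps ++ [N]) ++ Ns) by (rewrite <- app_assoc; auto).
      apply IH; auto. apply Forall_app; auto.
Qed.

Lemma lambda_mu_I_apps Ms : forall M,
  lambda_mu_I (apps M Ms) -> lambda_mu_I M /\ Forall lambda_mu_I Ms.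
Proof.
  induction Ms as [|P Ms IH]; intros M H; [auto|].
  apply (IH (App M P)) in H as (H1 & H2). inversion_clear H1. auto.
Qed.

Lemma apps_App M Ms P : exists A B, apps (App M P) Ms = App A B.
Proof.
  destruct Ms as [|Q Ms _] using rev_ind; [simpl; eauto|].
  rewrite apps_snoc. eauto.
Qed.

Lemma standard_list_nonempty M Ms ss Ns :
  standard_list (M :: Ms) ss Ns -> exists N Ns', Ns = N :: Ns'.
Proof. intros H. inversion H; eauto. Qed.

(** With [stops] in place of a normal form, the hypothesis passes to the initial parts in the theta-
    and rho-clauses. Clauses that keep a redex then either contradict normality or have an empty
    sequence. *)
Lemma standard_leftmost_mut :
  (forall M s N, standard M s N ->
    lambda_mu_I M -> stops M s N -> leftmost_reduction M s N) /\
  (forall Ms ss Ns, standard_list Ms ss Ns ->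
    Forall lambda_mu_I Ms -> Forall NF Ns -> Forall3 leftmost_reduction Ms ss Ns).
Proof.
  apply standard_standard_list_ind.
  - constructor.
  - intros M s N Hs IH HI HS. inversion_clear HI.
    apply leftmost_lam, IH; auto. inversion HS; subst.
    + apply stops_NF. intros p P Hp. eapply H1, S_lam, Hp.
    + destruct H1 as [-> | ->]; [destruct H2 as (? & ?) | destruct H2 as (? & ? & ?)];
        discriminate.
  - intros M s N Hs IH Hnev HI HS. inversion_clear HI.
    inversion HS; subst.
    + apply leftmost_mu; [|apply never_not_before_end; auto].
      apply IH; auto. apply stops_NF. intros p P Hp. eapply H1, S_mu, Hp.
    + destruct H1 as [-> | ->].
      (* The start is already a mu-abstraction, so nothing can precede the first one. *)
      * apply not_before_end_nil in H3; [|eexists; reflexivity].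
        apply map_eq_nil in H3 as ->. apply standard_reduces in Hs.
        inversion Hs. constructor.
      * destruct H2 as (? & ? & ?). discriminate.
  - intros M s1 U s2 N H1 IH1 Hth Hn H2 IH2 HI HS.
    assert (HR : reduces (Mu M) (under Body s1 ++ [[]]) (mu_lower U)).
    { eapply reduces_app.
      - apply reduces_under; auto using step. apply standard_reduces; eauto.
      - destruct Hth as (V & E & HV). injection E as ->.
        econstructor; [do 2 constructor; auto | constructor]. }
    eapply leftmost_app.
    + apply leftmost_mu; [|auto]. inversion_clear HI. apply IH1; [auto|].
      (* The initial part ends in the first body that makes the mu a theta-redex. *)
      apply stops_first with theta_body; auto.
      apply (not_before_end_under theta_body theta_redex Body Mu); auto using step.
    + econstructor.
      * apply lr_theta; auto.
      * destruct Hth as (V & E & HV). injection E as ->. do 2 constructor; auto.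
      * apply IH2.
        -- eapply reduces_lambda_mu_I in HR; [apply HR | auto].
        -- eapply stops_suffix; [exact HR|]. rewrite <- app_assoc. auto.
  - intros M s1 U s2 V H1 IH1 Hth Hn H2 IH2 HI HS.
    inversion HS; subst.
    (* [V] has the same free names as [U], so the final term is still a theta-redex and not
       normal. *)
    + exfalso. destruct Hth as (V' & E & HV). injection E as <-.
      apply standard_reduces in H1, H2. inversion_clear HI.
      apply reduces_lambda_mu_I in H1 as (H1 & _); auto. inversion_clear H1.
      apply reduces_lambda_mu_I in H2 as (_ & H2); auto.
      eapply H, S_root, C_theta. rewrite H2. auto.
    + destruct H as [-> | ->].
      * apply not_before_end_nil in H3; [|eexists; reflexivity].
        apply app_eq_nil in H3 as (E1 & E2). apply map_eq_nil in E1, E2.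
        apply map_eq_nil in E2. subst.
        apply standard_reduces in H1, H2. inversion H1. inversion H2. constructor.
      * destruct H0 as (? & ? & ?). discriminate.
  - intros a M s N Hs IH Hnev HI HS. inversion_clear HI.
    inversion HS; subst.
    + apply leftmost_named; [|apply never_not_before_end; auto].
      apply IH; auto. apply stops_NF. intros p P Hp. eapply H0, S_named, Hp.
    + destruct H0 as [-> | ->].
      * destruct H1 as (? & ?). discriminate.
      (* The final term has the form [0]N with 0 not free in N. Free names being preserved, the
         start already has this form, so the sequence is empty. *)
      * destruct H1 as (U & E & HU). injection E as -> ->.
        apply standard_reduces in Hs.
        apply not_before_end_nil in H2.
        -- apply map_eq_nil in H2 as ->. inversion Hs. constructor.
        -- exists M. split; [reflexivity|].
           apply reduces_lambda_mu_I in Hs as (_ & Hs); [|auto]. rewrite <- Hs. auto.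
  - intros a M s1 U s2 N H1 IH1 Hn H2 IH2 HI HS.
    assert (HR : reduces (Named a M) (under Body s1 ++ [[]]) (mu_rename0 a U)).
    { eapply reduces_app.
      - apply reduces_under; auto using step. apply standard_reduces; eauto.
      - econstructor; [do 2 constructor; auto | constructor]. }
    eapply leftmost_app.
    + apply leftmost_named; [|auto]. inversion_clear HI. apply IH1; [auto|].
      apply stops_first with is_mu; [auto | eexists; reflexivity |].
      apply (not_before_end_under is_mu rho_redex Body (Named a)); auto using step.
      intros ? (V & ->). unfold rho_redex; eauto.
    + econstructor.
      * apply lr_rho; unfold rho_redex; eauto.
      * do 2 constructor.
      * apply IH2.
        -- eapply reduces_lambda_mu_I in HR; [apply HR | auto].
        -- eapply stops_suffix; [exact HR|]. rewrite <- app_assoc. auto.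
  - intros a M s1 U s2 V H1 IH1 Hn H2 IH2 HI HS.
    inversion HS; subst.
    + destruct (H _ _ (S_root _ _ (C_rho a V))).
    + destruct H as [-> | ->].
      * destruct H0 as (? & ?). discriminate.
      * destruct H0 as (W & E & HW). injection E as -> <-. inversion_clear HI.
        apply not_before_end_nil in H3.
        -- apply app_eq_nil in H3 as (E1 & E2). apply map_eq_nil in E1, E2.
           apply map_eq_nil in E2. subst.
           apply standard_reduces in H1, H2. inversion H1. inversion H2. constructor.
        -- exists M. split; [reflexivity|].
           apply standard_reduces in H1, H2.
           apply reduces_lambda_mu_I in H1 as (I1 & F1); [|auto]. rewrite <- F1.
           inversion_clear I1.
           apply reduces_lambda_mu_I in H2 as (_ & F2); [|auto].
           simpl. rewrite <- F2. auto.
  - intros M1 M2 Ms s N Hs IH HI HS.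
    assert (HP : step (repeat Fun (length Ms)) (apps (Lam M1) (M2 :: Ms))
                   (apps (subst0 M2 M1) Ms))
      by (apply (contract_apps Ms (App (Lam M1) M2)); constructor).
    econstructor; [apply lr_head_beta | exact HP |]. apply IH.
    + eapply step_lambda_mu_I; eauto.
    + eapply (stops_suffix _ [_]); [|exact HS]. eauto using reduces.
  - intros M1 M2 Ms s1 ss N1 Ns H1 IH1 H2 IH2 HI HS. exfalso.
    (* The final term is an application, hence normal by the stopping condition, yet its head
       beta-redex is still there. *)
    apply standard_list_nonempty in H2 as (N2 & Ns' & ->).
    simpl in HS. destruct (apps_App (Lam N1) Ns' N2) as (A & B & E).
    unfold apps in *. simpl in HS. rewrite E in HS. apply stops_NF_of_App in HS.
    rewrite <- E in HS. apply apps_NF in HS. eapply HS, S_root, C_beta.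
  - intros M1 M2 Ms s N Hs IH HI HS.
    assert (HP : step (repeat Fun (length Ms)) (apps (Mu M1) (M2 :: Ms))
                   (apps (mu_contractum M1 M2) Ms))
      by (apply (contract_apps Ms (App (Mu M1) M2)); constructor).
    econstructor; [apply lr_head_mu | exact HP |]. apply IH.
    + eapply step_lambda_mu_I; eauto.
    + eapply (stops_suffix _ [_]); [|exact HS]. eauto using reduces.
  - intros M1 M2 Ms s1 ss N1 Ns H1 IH1 H2 IH2 HI HS. exfalso.
    apply standard_list_nonempty in H2 as (N2 & Ns' & ->).
    simpl in HS. destruct (apps_App (Mu N1) Ns' N2) as (A & B & E).
    unfold apps in *. simpl in HS. rewrite E in HS. apply stops_NF_of_App in HS.
    rewrite <- E in HS. apply apps_NF in HS. eapply HS, S_root, C_mu.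
  - intros x Ms ss Ns Hs IH HI HS.
    apply lambda_mu_I_apps in HI as (_ & HI).
    destruct Ns as [|N Ns]; [inversion Hs; constructor|].
    assert (HN : Forall NF (N :: Ns)).
    { apply apps_NF_args with (Var x).
      destruct (apps_App (Var x) Ns N) as (A & B & E).
      unfold apps in *. simpl in *. rewrite E in *. apply stops_NF_of_App in HS. auto. }
    apply (leftmost_var_apps x Ms ss (N :: Ns) (IH HI HN) HN []). auto.
  - constructor.
  - intros M s N Ms ss Ns H1 IH1 H2 IH2 HI HN.
    inversion_clear HI. inversion_clear HN.
    constructor; auto. apply IH1; auto. apply stops_NF; auto.
Qed.

Theorem theorem3p23 (M N : term) (s : redseq)
    (HT : typable M) (HI : lambda_mu_I M)
    (Hred : reduces M s N) (Hstd : standard M s N) (HN : NF N) :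
  leftmost_reduction M s N /\
  (forall (s' : redseq) (N' : term), reduces M s' N' -> length s' <= length s).
Proof.
  assert (leftmost_reduction M s N).
  { apply standard_leftmost_mut; [auto | auto | apply stops_NF; auto]. }
  split; [auto|]. intros s' N'. apply leftmost_maximal with N; auto.
Qed.
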